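(* Let $\alpha$ be a nonzero real number. Let $p_1,p_2\in\mathbb H^2$ be two points lying on a common geodesic with $N$. (1) If $p_1$ and $p_2$ lie on the same ray starting at $N$, then the segment of this ray joining $p_1$ and $p_2$ minimizes $E_\alpha$ among all curves in $\mathbb H^2$ joining $p_1$ and $p_2$, for every such $\alpha$. (2) Suppose $\alpha>0$. If $N$ lies on the geodesic segment between $p_1$ and $p_2$, then this geodesic segment minimizes $E_\alpha$ among all curves in $\mathbb H^2$ joining $p_1$ and $p_2$.
   Context: The hyperbolic plane is $\mathbb H^2=\{(x,y,z):x^2+y^2-z^2=-1,\ z>0\}$ with the metric induced by $\langle x,y\rangle_\epsilon=x_1y_1+x_2y_2-x_3y_3$. It is parametrized by $\Psi(u,v)=(\sinh u\cos v,\sinh u\sin v,\cosh u)$, and $N=(0,0,1)$. The hyperbolic distance from $\Psi(u,v)$ to $N$ is $u$. A ray starting at $N$ is a geodesic $u\mapsto\Psi(u,v_0)$, $u\ge0$, for some fixed $v_0$. For a curve $\gamma$, the energy is $E_\alpha[\gamma]=\int_\gamma\mathsf d^\alpha\,ds$, where $s$ is hyperbolic arc length and $\mathsf d$ is the hyperbolic distance to $N$. In coordinates, $$E_\alpha[\gamma]=\int u^\alpha\sqrt{u'^2+\sinh^2(u)v'^2}\,dt.$$ The paper discards the case $\alpha=0$. *)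

(* Defs.v *)
From HB Require Import structures.
From mathcomp Require Import all_boot all_order all_algebra.
From mathcomp Require Import all_classical all_reals all_analysis.
Set Implicit Arguments. Unset Strict Implicit. Unset Printing Implicit Defensive.
Import Order.TTheory GRing.Theory Num.Theory.
Import numFieldNormedType.Exports.
Local Open Scope classical_set_scope.
Local Open Scope ring_scope.

Section Hyp.
Variable R : realType.

Definition px (p : R * R * R) : R := p.1.1.
Definition py (p : R * R * R) : R := p.1.2.
Definition pz (p : R * R * R) : R := p.2.

Definition lor (p q : R * R * R) : R := px p * px q + py p * py q - pz p * pz q.

Definition onH2 (p : R * R * R) : Prop := lor p p = -1 /\ 0 < pz p.

Definition sinh (u : R) : R := (expR u - expR (- u)) / 2.
Definition cosh (u : R) : R := (expR u + expR (- u)) / 2.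
Definition arcosh (x : R) : R := ln (x + Num.sqrt (x ^+ 2 - 1)).

(* hyperbolic distance on H^2 : cosh d(p,q) = - <p,q>_eps *)
Definition hdist (p q : R * R * R) : R := arcosh (- lor p q).

Definition Npt : R * R * R := (0, 0, 1).

Definition Psi (u v : R) : R * R * R := (sinh u * cos v, sinh u * sin v, cosh u).

Definition cx (g : R -> R * R * R) := fun t => px (g t).
Definition cy (g : R -> R * R * R) := fun t => py (g t).
Definition cz (g : R -> R * R * R) := fun t => pz (g t).

(* g is C^1 on the closed interval [c,d] (one-sided at the ends):
   continuous on [c,d], differentiable on ]c,d[ with derivative extending
   continuously to [c,d]. *)
Definition C1_fun (f : R -> R) (c d : R) : Prop :=
  {within `[c, d], continuous f} /\
  (forall t, c < t < d -> derivable f t 1) /\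
  exists f' : R -> R, {within `[c, d], continuous f'} /\
    (forall t, c < t < d -> derive1 f t = f' t).

Definition C1_on (g : R -> R * R * R) (c d : R) : Prop :=
  C1_fun (cx g) c d /\ C1_fun (cy g) c d /\ C1_fun (cz g) c d.

Definition pwC1 (g : R -> R * R * R) (a b : R) : Prop :=
  exists s : seq R, let pts := a :: rcons s b in
    sorted <%R pts /\
    forall i : nat, (i <= size s)%N -> C1_on g (nth 0 pts i) (nth 0 pts i.+1).

Definition curve_joining (g : R -> R * R * R) (a b : R) (p q : R * R * R) : Prop :=
  a < b /\ (forall t, a <= t <= b -> onH2 (g t)) /\
  g a = p /\ g b = q /\ pwC1 g a b.

Definition hspeed (g : R -> R * R * R) (t : R) : R :=
  Num.sqrt (derive1 (cx g) t ^+ 2 + derive1 (cy g) t ^+ 2 - derive1 (cz g) t ^+ 2).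

Definition energy (alpha : R) (g : R -> R * R * R) (a b : R) : \bar R :=
  (\int[lebesgue_measure]_(t in `[a, b])
      ((hdist (g t) Npt) `^ alpha * hspeed g t)%:E)%E.

(* the geodesic through N in direction v0 : s |-> Psi(s, v0), s in R
   (for s < 0, Psi(s,v0) = Psi(-s, v0 + pi)); its segment from parameter
   s1 to s2, parametrized on [0,1]. *)
Definition geod_seg (v0 s1 s2 : R) : R -> R * R * R :=
  fun t => Psi (s1 + t * (s2 - s1)) v0.

End Hyp.

(* Main.v *)
Require Import Defs.
From HB Require Import structures.
From mathcomp Require Import all_boot all_order all_algebra.
From mathcomp Require Import all_classical all_reals all_analysis.
From mathcomp Require Import measurable_realfun ring lra.
Import Order.TTheory GRing.Theory Num.Theory.
Import numFieldNormedType.Exports.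
Local Open Scope classical_set_scope.
Local Open Scope ring_scope.
Set Implicit Arguments.
Unset Strict Implicit.
Unset Printing Implicit Defensive.

(** Both parts are calibration arguments: a function [f] along a curve whose
derivative is bounded by the density [u^alpha |g'|] has increment at most the
energy of the curve.

For points on one ray take [f = P(u)] with [P' = u^alpha]; then [|u'| <= |g'|]
gives the bound wherever [u > 0]. To stay away from [N], where [P] may be
singular, the inequality is applied on a portion of the curve on which [u]
stays above its smaller end value, compared with an inner part of the segment,
and the inner parts exhaust the segment.

For points on opposite rays and [alpha > 0], let [P(u) = u^(alpha+1)/(alpha+1)].
A curve through [N] is cut there and both halves are treated as above. A curve
avoiding [N] is calibrated by [P(u) cos(v - v0)]: mapping [(u, v)] to the point
of the Euclidean plane with polar coordinates [(P(u), v)] does not increase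
lengths, because [P(u) <= u^alpha sinh u], and the images of the end points are
at distance [P(|s1|) + P(s2)], the energy of the segment. *)

(** * Functions of class C1 on an interval *)

Section C1Functions.
Variable R : realType.
Implicit Types (c d t : R) (f : R -> R) (g : R -> R * R * R).

Lemma within_continuous_comp (A : set R) (f k : R -> R) :
  {within A, continuous f} -> (forall t, A t -> {for f t, continuous k}) ->
  {within A, continuous (k \o f)}.
Proof.
move=> /subspace_continuousP cf ck; apply/subspace_continuousP => t At.
by apply: (@cvg_comp _ _ _ f k _ _ _ (cf t At)); exact: ck.
Qed.

Lemma within_continuousM (A : set R) (f k : R -> R) :
  {within A, continuous f} -> {within A, continuous k} ->
  {within A, continuous (fun t => f t * k t)}.
Proof.
move=> /subspace_continuousP cf /subspace_continuousP ck.
by apply/subspace_continuousP => t At; apply: cvgM; [exact: cf|exact: ck].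
Qed.

Lemma within_continuousD (A : set R) (f k : R -> R) :
  {within A, continuous f} -> {within A, continuous k} ->
  {within A, continuous (fun t => f t + k t)}.
Proof.
move=> /subspace_continuousP cf /subspace_continuousP ck.
by apply/subspace_continuousP => t At; apply: cvgD; [exact: cf|exact: ck].
Qed.

(** Carrying [f'] explicitly gives a derivative that is continuous up to the end points, where the
    value of [derive1 f] is not controlled. *)
Definition C1_with (f f' : R -> R) c d : Prop :=
  [/\ {within `[c, d], continuous f}, {within `[c, d], continuous f'} &
   forall t, c < t < d -> is_derive t 1 f (f' t)].

Lemma C1_funP f c d : C1_fun f c d <-> exists f', C1_with f f' c d.
Proof.
split.
  move=> [cf [df [f' [cf' ff']]]]; exists f'; split => // t tcd.
  apply: DeriveDef; first exact: df.
  by rewrite -derive1E ff'.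
move=> [f' [cf cf' ff']]; split => //; split.
  by move=> t /ff' [].
exists f'; split => // t /ff' ?.
by rewrite derive1E derive_val.
Qed.

Lemma within_itvW f c d c' d' : c <= c' -> d' <= d ->
  {within `[c, d], continuous f} -> {within `[c', d'], continuous f}.
Proof.
move=> cc dd; apply: continuous_subspaceW => t /=.
by rewrite !in_itv /= => /andP[? ?]; apply/andP; split; [exact: le_trans cc _|exact: le_trans dd].
Qed.

Lemma C1_fun_sub f c d c' d' : c <= c' -> d' <= d ->
  C1_fun f c d -> C1_fun f c' d'.
Proof.
move=> cc dd /C1_funP [f' [cf cf' ff']]; apply/C1_funP; exists f'.
split; [exact: within_itvW cf|exact: within_itvW cf'|].
by move=> t /andP[ct td]; apply: ff'; rewrite (le_lt_trans cc ct) (lt_le_trans td dd).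
Qed.

Lemma C1_withM f f' k k' c d : C1_with f f' c d -> C1_with k k' c d ->
  C1_with (fun t => f t * k t) (fun t => f t * k' t + k t * f' t) c d.
Proof.
move=> [cf cf' ff'] [ck ck' kk']; split.
- exact: within_continuousM.
- by apply: within_continuousD; exact: within_continuousM.
- move=> t tcd; have := ff' _ tcd; have := kk' _ tcd => Hk Hf.
  by have := is_deriveM Hf Hk.
Qed.

Lemma C1_withD f f' k k' c d : C1_with f f' c d -> C1_with k k' c d ->
  C1_with (fun t => f t + k t) (fun t => f' t + k' t) c d.
Proof.
move=> [cf cf' ff'] [ck ck' kk']; split.
- exact: within_continuousD.
- exact: within_continuousD.
- move=> t tcd; have := ff' _ tcd; have := kk' _ tcd => Hk Hf.
  by have := is_deriveD Hf Hk.
Qed.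

Lemma C1_withZ (r : R) f f' c d : C1_with f f' c d ->
  C1_with (fun t => r * f t) (fun t => r * f' t) c d.
Proof.
move=> [cf cf' ff']; split.
- apply: (@within_continuousM _ (fun=> r)) => //.
  by apply: continuous_subspaceT => ?; exact: cvg_cst.
- apply: (@within_continuousM _ (fun=> r)) => //.
  by apply: continuous_subspaceT => ?; exact: cvg_cst.
- move=> t tcd; have Hf := ff' _ tcd.
  by have := is_deriveZ r Hf.
Qed.

Lemma C1_with_comp (k k' : R -> R) f f' c d : c < d -> C1_with f f' c d ->
  (forall t, c <= t <= d -> is_derive (f t) 1 k (k' (f t))) ->
  (forall t, c <= t <= d -> {for f t, continuous k'}) ->
  C1_with (fun t => k (f t)) (fun t => k' (f t) * f' t) c d.
Proof.
move=> cd [cf cf' ff'] kk' ck'.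
have ck : {within `[c, d], continuous (k \o f)}.
  apply: within_continuous_comp => // t; rewrite /= in_itv /= => tcd.
  have := kk' t tcd => -[dk _].
  by apply: differentiable_continuous; exact/derivable1_diffP.
split => //.
- apply: within_continuousM => //.
  by apply: (@within_continuous_comp _ f k') => // t; rewrite /= in_itv /=; exact: ck'.
- move=> t /[dup] /ff' ft /andP[/ltW ct /ltW td].
  by apply: is_derive1_comp => //; apply: kk'; rewrite ct.
Qed.

(** By induction on the break points. All later uses of [pwC1] go through this principle, so a
    subdivision only shows up as one smooth piece or one concatenation. *)
Lemma pwC1_ind (Q : R -> R -> Prop) g :
  (forall c d, c < d -> C1_on g c d -> Q c d) ->
  (forall c m d, c < m -> m < d -> Q c m -> Q m d -> Q c d) ->
  forall a b, pwC1 g a b -> Q a b.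
Proof.
move=> Qpiece Qcat a b [s]; elim: s a => [|m s IH] a /=.
  by rewrite andbT => -[ab /(_ 0%N erefl)]; exact: Qpiece.
move=> [/andP[am sm] C1g].
have mb : m < b.
  have := sm; rewrite (path_sortedE lt_trans) => /andP[/allP/(_ b)] + _.
  by rewrite mem_rcons mem_head; exact.
apply: (Qcat _ m) => //; first by apply: Qpiece => //; exact: (C1g 0%N).
by apply: IH; split => // i si; exact: (C1g i.+1).
Qed.

End C1Functions.

(** * Increments of piecewise C1 functions *)

Section Increments.
Variable R : realType.
Implicit Types (c d m t : R) (f e : R -> R) (g : R -> R * R * R).
Local Notation mu := (@lebesgue_measure R).

Lemma itv_cat c m d : c <= m -> m <= d -> `[c, d]%classic = `[c, m]%classic `|` `[m, d]%classic.
Proof.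
move=> cm md; apply/seteqP; split => t /=; rewrite !in_itv /=.
  move=> /andP[ct td]; have [tm|/ltW mt] := leP t m.
    by left; rewrite ct.
  by right; rewrite mt.
move=> [|] /andP[a1 a2]; rewrite ?a1 ?a2 ?andbT /=; first exact: le_trans md.
exact: le_trans a1.
Qed.

Lemma measurable_fun_itv_cat c m d f : c <= m -> m <= d ->
  measurable_fun `[c, m] f -> measurable_fun `[m, d] f -> measurable_fun `[c, d] f.
Proof. by move=> cm md mf1 mf2; rewrite (itv_cat cm md); apply/measurable_funU. Qed.

Lemma within_itv_cat c m d f : c <= m -> m <= d ->
  {within `[c, m], continuous f} -> {within `[m, d], continuous f} ->
  {within `[c, d], continuous f}.
Proof.
move=> cm md mf1 mf2; rewrite (itv_cat cm md).
by apply: withinU_continuous => //; exact: itv_closed.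
Qed.

Lemma measurable_fun_itvW c d c' d' f : c <= c' -> d' <= d ->
  measurable_fun `[c, d] f -> measurable_fun `[c', d'] f.
Proof.
move=> cc dd; apply: measurable_funS => // t /=.
by rewrite !in_itv /= => /andP[? ?]; apply/andP; split; [exact: le_trans cc _|exact: le_trans dd].
Qed.

Lemma ge0_integral_itvW c d c' d' e : c <= c' -> d' <= d ->
  measurable_fun `[c, d] e -> (forall t, 0 <= e t) ->
  (\int[mu]_(t in `[c', d']) (e t)%:E <= \int[mu]_(t in `[c, d]) (e t)%:E)%E.
Proof.
move=> cc dd me e0; apply: ge0_subset_integral => //.
- exact/measurable_EFinP.
- by move=> t _; rewrite lee_fin.
- move=> t /=.
  by rewrite !in_itv /= => /andP[? ?]; apply/andP; split; [exact: le_trans cc _|exact: le_trans dd].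
Qed.

Lemma ge0_integral_itv_cat c m d e : c <= m -> m <= d ->
  measurable_fun `[c, d] e -> (forall t, 0 <= e t) ->
  (\int[mu]_(t in `[c, d]) (e t)%:E =
   \int[mu]_(t in `[c, m]) (e t)%:E + \int[mu]_(t in `[m, d]) (e t)%:E)%E.
Proof.
move=> cm md me e0.
(* The right piece is taken open at [m] to make the union disjoint; a single point does not change
   the integral. *)
have mE : measurable_fun `]m, d] (EFin \o e).
  apply/measurable_EFinP; apply: measurable_funS me => // t /=.
  by rewrite !in_itv /= => /andP[/ltW mt ->]; rewrite (le_trans cm mt).
have Ecat : `[c, d]%classic = `[c, m]%classic `|` `]m, d]%classic.
  apply/seteqP; split => t /=; rewrite !in_itv /=.
    move=> /andP[ct td]; have [tm|mt] := leP t m; first by left; rewrite ct.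
    by right.
  move=> [|] /andP[a1 a2]; rewrite ?a1 ?a2 ?andbT /=; first exact: le_trans md.
  by rewrite (le_trans cm (ltW a1)).
rewrite -(integral_itv_obnd_cbnd mE) Ecat ge0_integral_setU //.
- by rewrite -Ecat; exact/measurable_EFinP.
- by move=> t _; rewrite lee_fin.
- rewrite disj_set2E; apply/eqP/seteqP; split => // t /=; rewrite !in_itv /=.
  by move=> [/andP[_ tm] /andP[mt _]]; move: (le_lt_trans tm mt); rewrite ltxx.
Qed.

Lemma C1_integral (f f' : R -> R) c d : c < d -> C1_with f f' c d ->
  (\int[mu]_(t in `[c, d]) (f' t)%:E = (f d - f c)%:E)%E.
Proof.
move=> cd [cf cf' ff']; rewrite (@continuous_FTC2 _ f' f) //.
- split.
  + by move=> t /[!in_itv]/= /ff' [].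
  + by move/(continuous_within_itvP _ cd): cf => [].
  + by move/(continuous_within_itvP _ cd): cf => [].
- by move=> t /[!in_itv]/= /ff' ?; rewrite derive1E derive_val.
Qed.

(** The fundamental theorem of calculus turns the increment into the integral of [f'], and the
    absolute value then passes under the integral. *)
Lemma C1_increment_le f f' e c d : c <= d -> C1_with f f' c d ->
  measurable_fun `[c, d] e -> (forall t, 0 <= e t) ->
  (forall t, c < t < d -> `|f' t| <= e t) ->
  (`|f d - f c|%:E <= \int[mu]_(t in `[c, d]) (e t)%:E)%E.
Proof.
rewrite le_eqVlt => /predU1P[<- _ _ e0 _|cd [cf cf' ff'] me e0 f'e].
  by rewrite subrr normr0; apply: integral_ge0 => t _; rewrite lee_fin.
rewrite -abse_EFin -(C1_integral cd (And3 cf cf' ff')).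
have mf' : measurable_fun `[c, d] f'.
  by apply: subspace_continuous_measurable_fun.
have moo (h : R -> R) : measurable_fun `[c, d] h -> measurable_fun `]c, d[ (EFin \o h).
  move=> mh; apply/measurable_EFinP; apply: measurable_funS mh => //.
  exact: subset_itv_oo_cc.
apply: (le_trans (le_abse_integral _ _ _)) => //; first exact/measurable_EFinP.
under eq_integral do rewrite abse_EFin.
have mnf' : measurable_fun `]c, d[ (EFin \o (fun t => `|f' t|)).
  by apply: moo; exact: measurableT_comp.
(* The bound of [|f'|] by [e] is known only inside, so both integrals are moved to the open
   interval, the ends being null. *)
rewrite (integral_itv_bndoo true false mnf') (integral_itv_bndoo true false (moo e me)).
apply: ge0_le_integral => //.
- by move=> t _; rewrite lee_fin.
- exact: (moo e me).
Qed.

(** The calibration inequality. The set [D] of parameters is kept apart from [[a, b]] because a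
    calibrating function may be singular where the curve meets [N]. *)
Lemma pwC1_increment_le (D : set R) g f e a b : pwC1 g a b ->
  measurable_fun `[a, b] e -> (forall t, 0 <= e t) ->
  (forall c d, c < d -> `[c, d] `<=` D -> C1_on g c d ->
    exists2 f', C1_with f f' c d & forall t, c < t < d -> `|f' t| <= e t) ->
  forall c d, a <= c -> c <= d -> d <= b -> `[c, d] `<=` D ->
  (`|f d - f c|%:E <= \int[mu]_(t in `[c, d]) (e t)%:E)%E.
Proof.
move=> gab mab e0 Hf; move: mab; move: gab.
have e0' (A : set R) : (0 <= \int[mu]_(t in A) (e t)%:E)%E.
  by apply: integral_ge0 => t _; rewrite lee_fin.
apply: (@pwC1_ind _ (fun a b => measurable_fun `[a, b] e ->
  forall c d, a <= c -> c <= d -> d <= b -> `[c, d] `<=` D ->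
  (`|f d - f c|%:E <= \int[mu]_(t in `[c, d]) (e t)%:E)%E)) => {a b}.
- move=> a b ab [gx [gy gz]] me c d ac cd db cdD.
  move: cd; rewrite le_eqVlt => /predU1P[<-|cd]; first by rewrite subrr normr0.
  have [||f' ff' f'e] := Hf c d cd => //.
    by split; [|split]; exact: (C1_fun_sub ac db).
  apply: (C1_increment_le (ltW cd) ff') => //.
  exact: measurable_fun_itvW me.
- move=> a m b am mb IHl IHr me c d ac cd db cdD.
  have mel : measurable_fun `[a, m] e by apply: measurable_fun_itvW me => //; exact: ltW.
  have mer : measurable_fun `[m, b] e by apply: measurable_fun_itvW me => //; exact: ltW.
  (* An interval on one side of the break point [m] falls under one induction hypothesis; one that
     straddles [m] is cut there. *)
  have [dm|/ltW md] := leP d m; first exact: IHl.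
  have [mc|/ltW cm] := leP m c; first exact: IHr.
  rewrite (@ge0_integral_itv_cat c m) //; last exact: measurable_fun_itvW me.
  apply: (@le_trans _ _ (`|f m - f c|%:E + `|f d - f m|%:E)%E).
    by rewrite -EFinD lee_fin (_ : f d - f c = (f m - f c) + (f d - f m)) ?ler_normD //; ring.
  apply: leeD.
    apply: IHl => //; apply: subset_trans cdD => t /=.
    by rewrite !in_itv /= => /andP[-> tm]; exact: le_trans md.
  apply: IHr => //; apply: subset_trans cdD => t /=.
  by rewrite !in_itv /= => /andP[mt ->]; rewrite (le_trans cm mt).
Qed.

Lemma pwC1_continuous g a b : pwC1 g a b ->
  [/\ {within `[a, b], continuous (cx g)}, {within `[a, b], continuous (cy g)}
    & {within `[a, b], continuous (cz g)}].
Proof.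
apply: (@pwC1_ind _ (fun a b => [/\ {within `[a, b], continuous (cx g)},
    {within `[a, b], continuous (cy g)}
    & {within `[a, b], continuous (cz g)}])) => {a b}.
  by move=> c d _ [[? _] [[? _] [? _]]].
move=> c m d /ltW cm /ltW md [? ? ?] [? ? ?].
by split; apply: (within_itv_cat cm md).
Qed.

(** [derive1 f] agrees with a continuous function on the open interval, and its two end values do
    not affect measurability. *)
Lemma measurable_derive1_C1 f c d : C1_fun f c d -> measurable_fun `[c, d] (derive1 f).
Proof.
move=> [_ [_ [f' [cf' ff']]]].
apply: (@measurable_fun_itv_cc _ _ _ false true).
apply: (@eq_measurable_fun _ _ _ _ _ f').
  by move=> t; rewrite inE /= in_itv /= => /ff' ->.
apply: (@measurable_funS _ _ _ _ `[c, d]) => //; first exact: subset_itv_oo_cc.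
exact: subspace_continuous_measurable_fun.
Qed.

Lemma measurable_hspeed g a b : pwC1 g a b -> measurable_fun `[a, b] (hspeed g).
Proof.
apply: (@pwC1_ind _ (fun a b => measurable_fun `[a, b] (hspeed g))) => {a b}.
  move=> c d _ [/measurable_derive1_C1 mx [/measurable_derive1_C1 my /measurable_derive1_C1 mz]].
  apply: (@measurableT_comp _ _ _ _ _ _ (@Num.sqrt R)).
    by apply: continuous_measurable_fun; exact: sqrt_continuous.
  apply: measurable_funB; first apply: measurable_funD.
  - exact: measurable_funX.
  - exact: measurable_funX.
  - exact: measurable_funX.
by move=> c m d /ltW cm /ltW md; exact: measurable_fun_itv_cat.
Qed.

End Increments.

(** * Hyperbolic functions *)

Section HyperbolicFunctions.
Variable R : realType.
Implicit Types (u x y z w : R).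

Lemma cosh2_sinh2 u : cosh u ^+ 2 - sinh u ^+ 2 = 1.
Proof.
have e0 := expR_eq0 u.
by rewrite /cosh /sinh expRN; field; apply/negbT.
Qed.

Lemma is_derive_expRN u : is_derive u 1 (fun v : R => expR (- v)) (- expR (- u)).
Proof.
by have := is_derive1_comp (is_derive_expR (- u)) (is_deriveNid u 1); rewrite mulrN1.
Qed.

Lemma sinhN u : sinh (- u) = - sinh u.
Proof. by rewrite /sinh opprK; ring. Qed.

Lemma coshN u : cosh (- u) = cosh u.
Proof. by rewrite /cosh opprK addrC. Qed.

Lemma is_derive_sinh u : is_derive u 1 (@sinh R) (cosh u).
Proof.
rewrite /sinh.
have := is_deriveZ (2^-1 : R) (is_deriveB (is_derive_expR u) (is_derive_expRN u)).
rewrite (_ : _ \*: _ = fun v => (expR v - expR (- v)) / 2); last by apply/funext => v; rewrite mulrC.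
by move=> h; apply: is_derive_eq; rewrite /cosh opprK mulrC.
Qed.

Lemma is_derive_cosh u : is_derive u 1 (@cosh R) (sinh u).
Proof.
rewrite /cosh.
have := is_deriveZ (2^-1 : R) (is_deriveD (is_derive_expR u) (is_derive_expRN u)).
rewrite (_ : _ \*: _ = fun v => (expR v + expR (- v)) / 2); last by apply/funext => v; rewrite mulrC.
by move=> h; apply: is_derive_eq; rewrite /sinh mulrC.
Qed.

Lemma cosh_ge1 u : 1 <= cosh u.
Proof.
have eN : expR u * expR (- u) = 1 by rewrite -expRD subrr expR0.
(* This product equals [2 * (cosh u - 1)]. *)
have : 0 <= (expR u - 1) ^+ 2 * expR (- u) by rewrite mulr_ge0 ?sqr_ge0 ?expR_ge0.
rewrite (_ : _ * _ = expR u * (expR u * expR (- u)) - 2 * (expR u * expR (- u)) + expR (- u)); last ring.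
by rewrite eN /cosh; lra.
Qed.

(** The difference [sinh v - v] vanishes at [0] and has derivative [cosh v - 1 >= 0]. *)
Lemma sinh_ge_id u : 0 <= u -> u <= sinh u.
Proof.
move=> u0; rewrite -subr_ge0.
have D (t : R) : is_derive t 1 (fun v : R => sinh v - v) (cosh t - 1).
  exact: (is_deriveB (is_derive_sinh t) (is_derive_id t 1)).
suff : sinh 0 - 0 <= sinh u - u by rewrite subr0 {1}/sinh oppr0 subrr mul0r.
apply: (@ger0_derive1_ndecry _ (fun v : R => sinh v - v) 0) => //.
- by move=> t _; rewrite derive1E; have := D t => ?; rewrite derive_val subr_ge0 cosh_ge1.
- apply: continuous_subspaceT => t.
  by apply: differentiable_continuous; apply/derivable1_diffP; have [] := D t.
Qed.

Lemma arcosh_cosh u : arcosh (cosh u) = `|u|.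
Proof.
rewrite /arcosh (_ : _ - 1 = sinh u ^+ 2) ?sqrtr_sqr; last by rewrite -(cosh2_sinh2 u); ring.
have [u0|/ltW u0] := leP 0 u.
  rewrite !ger0_norm //; last exact: le_trans (sinh_ge_id u0).
  by rewrite -[RHS]expRK; congr ln; rewrite /cosh /sinh; field.
have s0 : sinh u <= 0.
  by rewrite -oppr_ge0 -sinhN; apply: le_trans (sinh_ge_id _); rewrite oppr_ge0.
by rewrite !ler0_norm // -[RHS]expRK; congr ln; rewrite /cosh /sinh; field.
Qed.

Lemma arcosh_sum_ge1 z : 1 <= z -> 1 <= z + Num.sqrt (z ^+ 2 - 1).
Proof. by move=> z1; rewrite -[leLHS]addr0 lerD // sqrtr_ge0. Qed.

Lemma arcosh_ge0 z : 1 <= z -> 0 <= arcosh z.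
Proof. by move=> /arcosh_sum_ge1; exact: ln_ge0. Qed.

Lemma arcosh_gt0 z : 1 < z -> 0 < arcosh z.
Proof.
move=> z1; apply: ln_gt0; apply: lt_le_trans z1 _.
by rewrite lerDl sqrtr_ge0.
Qed.

Lemma cosh_arcosh z : 1 <= z -> cosh (arcosh z) = z.
Proof.
move=> z1; have a1 := arcosh_sum_ge1 z1.
have a0 : 0 < z + Num.sqrt (z ^+ 2 - 1) by exact: lt_le_trans a1.
rewrite /cosh /arcosh expRN lnK ?posrE //.
have S0 := sqrtr_ge0 (z ^+ 2 - 1).
have S2 : Num.sqrt (z ^+ 2 - 1) ^+ 2 = z ^+ 2 - 1 by rewrite sqr_sqrtr // subr_ge0 exprn_ege1.
set S := Num.sqrt _ in a0 S2 *.
(* Indeed [(z + S) * (z - S) = z ^+ 2 - S ^+ 2 = 1]. *)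
have -> : (z + S)^-1 = z - S.
  apply: (@mulfI _ (z + S)); first exact: lt0r_neq0.
  by rewrite mulfV ?lt0r_neq0 // mulrC -subr_sqr S2; ring.
by field.
Qed.

Lemma sinh_arcosh z : 1 <= z -> sinh (arcosh z) = Num.sqrt (z ^+ 2 - 1).
Proof.
move=> z1; have c := cosh_arcosh z1.
have := cosh2_sinh2 (arcosh z); rewrite c => E.
rewrite (_ : z ^+ 2 - 1 = sinh (arcosh z) ^+ 2) ?sqrtr_sqr ?ger0_norm //; last by rewrite -[X in _ - X]E; ring.
have a0 := arcosh_ge0 z1; exact: le_trans (sinh_ge_id a0).
Qed.

Lemma continuous_sqrtB1 z : {for z, continuous (fun v : R => Num.sqrt (v ^+ 2 - 1))}.
Proof.
apply: (@continuous_comp _ _ _ (fun v : R => v ^+ 2 - 1) (@Num.sqrt R)); last exact: sqrt_continuous.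
apply: continuousB; last exact: cvg_cst.
exact: exprn_continuous.
Qed.

Lemma continuous_arcosh z : 1 <= z -> {for z, continuous (@arcosh R)}.
Proof.
move=> z1; apply: (@continuous_comp _ _ _ (fun v : R => v + Num.sqrt (v ^+ 2 - 1)) (@ln R)).
  by apply: continuousD; [exact: cvg_id|exact: continuous_sqrtB1].
by apply: continuous_ln; apply: lt_le_trans (arcosh_sum_ge1 z1).
Qed.

Lemma sqrtB1_gt0 z : 1 < z -> 0 < Num.sqrt (z ^+ 2 - 1).
Proof. by move=> z1; rewrite sqrtr_gt0 subr_gt0 exprn_egt1. Qed.

Lemma is_derive_sqrtB1 z : 1 < z ->
  is_derive z 1 (fun v : R => Num.sqrt (v ^+ 2 - 1)) (z / Num.sqrt (z ^+ 2 - 1)).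
Proof.
move=> z1; have S0 := sqrtB1_gt0 z1.
have D2 : is_derive z 1 (fun v : R => v ^+ 2 - 1) (2 * z).
  have := is_deriveB (is_deriveX 2 (is_derive_id z (1:R))) (is_derive_cst (1:R) z 1).
  by move=> h; apply: is_derive_eq; rewrite subr0 expr1 -mulr_natl scaler1 /=.
have z20 : 0 < z ^+ 2 - 1 by rewrite subr_gt0 exprn_egt1.
have h := @is_derive1_comp _ (@Num.sqrt R) (fun v : R => v ^+ 2 - 1) z _ _ (is_derive1_sqrt z20) D2.
apply: is_derive_eq.
by have S00 := lt0r_neq0 S0; field.
Qed.

Lemma is_derive_arcosh z : 1 < z ->
  is_derive z 1 (@arcosh R) (Num.sqrt (z ^+ 2 - 1))^-1.
Proof.
move=> z1; have S0 := sqrtB1_gt0 z1.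
have D := is_deriveD (is_derive_id z (1:R)) (is_derive_sqrtB1 z1).
have zS : 0 < z + Num.sqrt (z ^+ 2 - 1) by rewrite addr_gt0 // (lt_trans _ z1).
have h := @is_derive1_comp _ (@ln R) (fun v : R => v + Num.sqrt (v ^+ 2 - 1)) z _ _ (is_derive1_ln zS) D.
apply: is_derive_eq.
have zS0 := lt0r_neq0 zS; have S00 := lt0r_neq0 S0; field.
by rewrite S00 zS0.
Qed.

Lemma Npt_hdistE (p : R * R * R) : hdist p (@Npt R) = arcosh (pz p).
Proof. by rewrite /hdist /lor /Npt /px /py /pz /= !mulr0 !add0r mulr1 opprK. Qed.

Lemma onH2_ge1 (p : R * R * R) : onH2 p -> 1 <= pz p.
Proof.
rewrite /onH2 /lor => -[E z0].
nra.
Qed.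

Lemma onH2_sqr (p : R * R * R) : onH2 p -> px p ^+ 2 + py p ^+ 2 = pz p ^+ 2 - 1.
Proof.
rewrite /onH2 /lor => -[E z0].
by rewrite !expr2; lra.
Qed.

Lemma continuous_powRl (a u : R) : 0 < u -> {for u, continuous (fun v : R => v `^ a)}.
Proof.
move=> u0; apply: differentiable_continuous; apply/derivable1_diffP.
by apply: derivable_powR; rewrite in_itv /= u0.
Qed.

Lemma is_derive_powR_primitive (alpha u : R) : alpha + 1 != 0 -> 0 < u ->
  is_derive u 1 (fun v : R => v `^ (alpha + 1) / (alpha + 1)) (u `^ alpha).
Proof.
move=> a10 u0.
have := is_deriveZ (alpha + 1)^-1 (is_derive1_powR (alpha + 1) u0).
rewrite (_ : _ \*: _ = fun v : R => v `^ (alpha + 1) / (alpha + 1)); last first.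
  by apply/funext => v; rewrite mulrC.
by move=> h; apply: is_derive_eq; rewrite /GRing.scale /= mulKf // addrK.
Qed.

(** The exponent [-1] calls for the logarithm, so [P] is only asserted to exist; the radial
    calibration uses nothing but its derivative. *)
Lemma powR_primitive (alpha : R) :
  exists P : R -> R, forall u, 0 < u -> is_derive u 1 P (u `^ alpha).
Proof.
have [->|a1] := eqVneq alpha (-1).
  by exists (@ln R) => u u0; rewrite powR_inv1 ?ltW //; exact: is_derive1_ln.
exists (fun v => v `^ (alpha + 1) / (alpha + 1)) => u u0.
by apply: is_derive_powR_primitive; rewrite // addr_eq0.
Qed.

End HyperbolicFunctions.

(** * The energy density along a curve in the hyperbolic plane *)

Section EnergyDensity.
Variable R : realType.
Implicit Types (c d t : R) (g : R -> R * R * R).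

Definition density (alpha : R) g t : R := hdist (g t) (@Npt R) `^ alpha * hspeed g t.

Lemma density_ge0 alpha g t : 0 <= density alpha g t.
Proof. by rewrite mulr_ge0 ?powR_ge0 ?sqrtr_ge0. Qed.

Lemma hdist_continuous g (A : set R) : {within A, continuous (cz g)} ->
  (forall t, A t -> onH2 (g t)) ->
  {within A, continuous (fun t => hdist (g t) (@Npt R))}.
Proof.
move=> cg Hg; rewrite (_ : (fun t => _) = @arcosh R \o cz g); last first.
  by apply/funext => t; rewrite Npt_hdistE.
by apply: within_continuous_comp => // t /Hg /onH2_ge1; exact: continuous_arcosh.
Qed.

Lemma measurable_density alpha g a b : pwC1 g a b ->
  (forall t, a <= t <= b -> onH2 (g t)) -> measurable_fun `[a, b] (density alpha g).
Proof.
move=> gab Hg; apply: measurable_funM; last exact: measurable_hspeed.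
apply: (@measurableT_comp _ _ _ _ _ _ (fun v : R => v `^ alpha)); first exact: measurable_powR.
apply: subspace_continuous_measurable_fun => //.
apply: hdist_continuous; first by case: (pwC1_continuous gab).
by move=> t /=; rewrite in_itv; exact: Hg.
Qed.

(** The equation [lor (g s) (g s) = -1] holds for [s] near [t], so its derivative vanishes: the
    velocity is Lorentz orthogonal to the position. *)
Lemma onH2_tangent g c d t (x' y' z' : R) :
  (forall s, c <= s <= d -> onH2 (g s)) -> c < t < d ->
  is_derive t 1 (cx g) x' -> is_derive t 1 (cy g) y' -> is_derive t 1 (cz g) z' ->
  cx g t * x' + cy g t * y' = cz g t * z'.
Proof.
move=> Hg tcd Dx Dy Dz.
have D := is_deriveB (is_deriveD (is_deriveM Dx Dx) (is_deriveM Dy Dy)) (is_deriveM Dz Dz).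
have ne : \forall s \near t, cx g s * cx g s + cy g s * cy g s - cz g s * cz g s = -1.
  have : t \in `]c, d[ by rewrite in_itv.
  move=> /near_in_itvoo; apply: filterS => s; rewrite in_itv /= => /andP[/ltW cs /ltW sd].
  by have [|+ _] := Hg s; [rewrite cs|].
have D0' : 'D_1 (cx g * cx g + cy g * cy g - cz g * cz g) t = 0.
  rewrite -[RHS](@derive_cst R R R (-1) t 1).
  by apply: near_eq_derive.
move: D0'; rewrite derive_val /GRing.scale /=; lra.
Qed.

(** With [z = cosh u] one has [z' = sinh u * u'] and [x * y' - y * x' = sinh u ^+ 2 * v']. This is
    the polar form of the metric multiplied by [sinh u ^+ 2], written without angles or
    divisions. *)
Lemma tangent_identity (x y z x' y' z' : R) :
  x ^+ 2 + y ^+ 2 = z ^+ 2 - 1 -> x * x' + y * y' = z * z' ->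
  (z ^+ 2 - 1) * (x' ^+ 2 + y' ^+ 2 - z' ^+ 2) = z' ^+ 2 + (x * y' - y * x') ^+ 2.
Proof.
move=> E E'.
rewrite mulrBr -{1}E.
(* Lagrange's identity. *)
rewrite (_ : (x ^+ 2 + y ^+ 2) * _ = (x * x' + y * y') ^+ 2 + (x * y' - y * x') ^+ 2); last ring.
by rewrite E'; ring.
Qed.

(** Both calibration bounds are reduced to this form; the factor [S ^+ 2], with [S = sinh u], makes
    [tangent_identity] applicable to the squared speed [s]. *)
Lemma sqr_le_sqrt (X w s S : R) : 0 < S -> 0 <= w ->
  (S * X) ^+ 2 <= w ^+ 2 * (S ^+ 2 * s) -> `|X| <= w * Num.sqrt s.
Proof.
move=> S0 w0 H.
have : X ^+ 2 <= w ^+ 2 * s.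
  rewrite -(ler_pM2l (exprn_gt0 2 S0)) -exprMn; apply: le_trans H _.
  by rewrite le_eqVlt; apply/orP; left; apply/eqP; ring.
move=> H2; rewrite -sqrtr_sqr -[in leRHS](ger0_norm w0) -[in leRHS]sqrtr_sqr.
by rewrite -sqrtrM ?sqr_ge0 //; exact: ler_wsqrtr.
Qed.

(** Since [z' / S] is [u'], the left side is [|w * u'|]; the bound follows by dropping the angular
    term of [tangent_identity]. *)
Lemma radial_bound (x y z x' y' z' S w : R) : 0 < S -> S ^+ 2 = z ^+ 2 - 1 -> 0 <= w ->
  x ^+ 2 + y ^+ 2 = z ^+ 2 - 1 -> x * x' + y * y' = z * z' ->
  `|w / S * z'| <= w * Num.sqrt (x' ^+ 2 + y' ^+ 2 - z' ^+ 2).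
Proof.
move=> S0 S2 w0 E E'; apply: (sqr_le_sqrt S0 w0).
rewrite S2 (tangent_identity E E').
rewrite (_ : S * (w / S * z') = w * z'); last by field; exact: lt0r_neq0.
by rewrite exprMn ler_wpM2l ?sqr_ge0 // lerDl sqr_ge0.
Qed.

(* Cauchy-Schwarz for the differential [w cos(v - v0) du - P sin(v - v0) dv] of
   [P(u) cos(v - v0)], where [S = sinh u], [z = cosh u] and [(k, l) = (cos v0, sin v0)]. *)
Lemma planar_bound (x y z x' y' z' S w P k l : R) : 0 < S -> S ^+ 2 = z ^+ 2 - 1 -> 0 <= w ->
  x ^+ 2 + y ^+ 2 = z ^+ 2 - 1 -> x * x' + y * y' = z * z' ->
  0 <= P -> P <= w * S -> k ^+ 2 + l ^+ 2 = 1 ->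
  `|(k * x + l * y) * ((w / S / S - P * (z / S ^+ 3)) * z') + P / S * (k * x' + l * y')|
  <= w * Num.sqrt (x' ^+ 2 + y' ^+ 2 - z' ^+ 2).
Proof.
move=> S0 S2 w0 E E' P0 PwS kl; apply: (sqr_le_sqrt S0 w0).
rewrite S2 (tangent_identity E E').
set J := x * y' - y * x'.
(* In polar coordinates [L = S * cos (v - v0)] and [K = - S * sin (v - v0)]. The next identity
   splits the derivative of [L] into a radial part, with [z'], and an angular part, with [J]. *)
pose L := k * x + l * y; pose K := l * x - k * y.
have S00 := lt0r_neq0 S0.
have L'E : k * x' + l * y' = (z * z' * L + J * K) / S ^+ 2.
  apply: (@mulfI _ (S ^+ 2)); first by rewrite expf_neq0.
  rewrite [RHS]mulrC divfK ?expf_neq0 // -E' S2 -E /L /K /J; ring.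
rewrite L'E -/L.
rewrite (_ : S * _ = (J * K * P + L * z' * w * S) / S ^+ 2); last by field.
have KL : K ^+ 2 + L ^+ 2 = S ^+ 2.
  rewrite S2 -E -[RHS]mul1r -kl /K /L; ring.
(* Cauchy-Schwarz for the vectors [(K, L)] and [(J * P, S * z' * w)]. *)
have CS : (J * K * P + L * z' * w * S) ^+ 2 <= (K ^+ 2 + L ^+ 2) * (J ^+ 2 * P ^+ 2 + S ^+ 2 * z' ^+ 2 * w ^+ 2).
  rewrite -subr_ge0 (_ : _ - _ = (K * z' * w * S - L * J * P) ^+ 2) ?sqr_ge0 //; ring.
rewrite expr_div_n ler_pdivrMr ?exprn_gt0 //; apply: le_trans CS _.
rewrite KL.
(* This controls the angular term: it is the reason why the map to the Euclidean plane does not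
   increase lengths. *)
have P2 : P ^+ 2 <= w ^+ 2 * S ^+ 2 by rewrite -exprMn ler_sqr ?nnegrE // mulr_ge0 // ltW.
rewrite (_ : w ^+ 2 * _ * _ = S ^+ 2 * (J ^+ 2 * (w ^+ 2 * S ^+ 2) + S ^+ 2 * z' ^+ 2 * w ^+ 2)); last ring.
by rewrite ler_wpM2l ?sqr_ge0 // lerD2r ler_wpM2l ?sqr_ge0.
Qed.

End EnergyDensity.

(** * Calibrating functions along smooth pieces *)

Section Calibrations.
Variable R : realType.
Implicit Types (c d t : R) (g : R -> R * R * R).

Lemma continuous_invsqrtB1 (z : R) : 1 < z ->
  {for z, continuous (fun v : R => (Num.sqrt (v ^+ 2 - 1))^-1)}.
Proof.
move=> z1; apply: continuousV; last exact: continuous_sqrtB1.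
by rewrite lt0r_neq0 // sqrtB1_gt0.
Qed.

(** The chain rule through [arcosh], which is smooth only for [z > 1], that is, away from [N];
    [radial_bound] then compares the derivative with the density. *)
Lemma radial_C1 (alpha : R) (P : R -> R) g c d : c < d -> C1_on g c d ->
  (forall t, c <= t <= d -> onH2 (g t)) -> (forall t, c <= t <= d -> 1 < cz g t) ->
  (forall u : R, 0 < u -> is_derive u 1 P (u `^ alpha)) ->
  exists2 f', C1_with (fun t => P (hdist (g t) (@Npt R))) f' c d &
    forall t, c < t < d -> `|f' t| <= density alpha g t.
Proof.
move=> cd [/C1_funP[x' Cx] [/C1_funP[y' Cy] /C1_funP[z' Cz]]] Hg z1 DP.
pose h (z : R) := arcosh z `^ alpha / Num.sqrt (z ^+ 2 - 1).
exists (fun t => h (cz g t) * z' t).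
  rewrite (_ : (fun t => _) = (fun t => (P \o @arcosh R) (cz g t))); last first.
    by apply/funext => t; rewrite Npt_hdistE.
  apply: C1_with_comp => // t /z1 zt.
    by apply: is_derive1_comp; [apply: DP; exact: arcosh_gt0|exact: is_derive_arcosh].
  apply: continuousM; last exact: continuous_invsqrtB1.
  apply: (@continuous_comp _ _ _ (@arcosh R) (fun v : R => v `^ alpha)).
    by apply: continuous_arcosh; exact: ltW.
  by apply: continuous_powRl; exact: arcosh_gt0.
move=> t tcd; have /andP[/ltW ct /ltW td] := tcd.
have ctd : c <= t <= d by rewrite ct.
have Dx : is_derive t 1 (cx g) (x' t) by case: Cx => _ _; exact.
have Dy : is_derive t 1 (cy g) (y' t) by case: Cy => _ _; exact.
have Dz : is_derive t 1 (cz g) (z' t) by case: Cz => _ _; exact.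
rewrite /density /hspeed !derive1E !derive_val Npt_hdistE.
apply: (@radial_bound _ (cx g t) (cy g t) (cz g t)).
- exact: sqrtB1_gt0 (z1 t ctd).
- by rewrite sqr_sqrtr // subr_ge0 exprn_ege1 // ltW // z1.
- exact: powR_ge0.
- exact: onH2_sqr (Hg t ctd).
- exact: (onH2_tangent Hg tcd).
Qed.

(** Because [alpha + 1 >= 1], one has [u / (alpha + 1) <= u <= sinh u]. *)
Lemma powR_primitive_le_sinh (alpha u : R) : 0 < alpha -> 0 <= u ->
  u `^ (alpha + 1) / (alpha + 1) <= u `^ alpha * sinh u.
Proof.
move=> a0 u0; rewrite powRD; last by rewrite gt_eqF ?ltr_wpDr // addr_gt0.
rewrite powRr1 // -mulrA ler_wpM2l ?powR_ge0 //.
apply: le_trans (sinh_ge_id u0).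
by rewrite ler_pdivrMr ?addr_gt0 // ler_peMr // lerDr ltW.
Qed.

(* In polar coordinates, [P(u) cos(v - v0)] with [P(u) = u^(alpha+1)/(alpha+1)] and
   [(k, l) = (cos v0, sin v0)]; division by [0] makes it vanish at [N]. *)
Definition planar (alpha k l : R) (p : R * R * R) : R :=
  (k * px p + l * py p) *
  (arcosh (pz p) `^ (alpha + 1) / (alpha + 1) / Num.sqrt (pz p ^+ 2 - 1)).

Lemma planar_C1 (alpha k l : R) g c d : 0 < alpha -> k ^+ 2 + l ^+ 2 = 1 ->
  c < d -> C1_on g c d ->
  (forall t, c <= t <= d -> onH2 (g t)) -> (forall t, c <= t <= d -> 1 < cz g t) ->
  exists2 f', C1_with (fun t => planar alpha k l (g t)) f' c d &
    forall t, c < t < d -> `|f' t| <= density alpha g t.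
Proof.
move=> a0 kl cd [/C1_funP[x' Cx] [/C1_funP[y' Cy] /C1_funP[z' Cz]]] Hg z1.
pose P (z : R) := arcosh z `^ (alpha + 1) / (alpha + 1).
pose S (z : R) := Num.sqrt (z ^+ 2 - 1).
(* [h] is the derivative of [P / S], as [S] has derivative [z / S]. Thus [planar] is a linear
   function of [x] and [y] times a function of [z] alone, and the product rule applies. *)
pose h (z : R) := arcosh z `^ alpha / S z / S z - P z * (z / S z ^+ 3).
have a10 : alpha + 1 != 0 by rewrite gt_eqF // addr_gt0.
have DP (z : R) : 1 < z -> is_derive z 1 P (arcosh z `^ alpha / S z).
  move=> zt1; apply: (is_derive1_comp (f := fun v : R => v `^ (alpha + 1) / (alpha + 1))).
    exact: is_derive_powR_primitive (arcosh_gt0 zt1).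
  exact: is_derive_arcosh.
have cP (z : R) : 1 < z -> {for z, continuous P}.
  by move=> zt1; apply: differentiable_continuous; apply/derivable1_diffP; have [] := DP z zt1.
have CG : C1_with (fun t => P (cz g t) / S (cz g t)) (fun t => h (cz g t) * z' t) c d.
  apply: (@C1_with_comp _ (fun z => P z / S z)) => // t /z1 zt.
    have S0 := sqrtB1_gt0 zt.
    have DS := is_deriveV (f := S) (lt0r_neq0 S0) (is_derive_sqrtB1 zt).
    have D := is_deriveM (DP _ zt) DS.
    apply: is_derive_eq; rewrite /GRing.scale /= /h.
    by have := lt0r_neq0 S0; rewrite -/(S _) => S00; field; rewrite S00.
  have cV := continuous_invsqrtB1 zt.
  apply: continuousB.
    do 2 (apply: continuousM; last exact: cV).
    apply: (@continuous_comp _ _ _ (@arcosh R) (fun v : R => v `^ alpha)).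
      by apply: continuous_arcosh; exact: ltW.
    by apply: continuous_powRl; exact: arcosh_gt0.
  apply: continuousM; first exact: cP.
  apply: continuousM; first exact: cvg_id.
  rewrite (_ : (fun=> _) = (fun v : R => (Num.sqrt (v ^+ 2 - 1))^-1 ^+ 3)); last first.
    by apply/funext => v; rewrite exprVn.
  apply: (@continuous_comp _ _ _ (fun v : R => (Num.sqrt (v ^+ 2 - 1))^-1) (fun v : R => v ^+ 3)) => //.
  exact: exprn_continuous.
have CL := C1_withD (C1_withZ k Cx) (C1_withZ l Cy).
eexists; first exact: (C1_withM CL CG).
move=> t tcd; have /andP[/ltW ct /ltW td] := tcd.
have ctd : c <= t <= d by rewrite ct.
have Dx : is_derive t 1 (cx g) (x' t) by case: Cx => _ _; exact.
have Dy : is_derive t 1 (cy g) (y' t) by case: Cy => _ _; exact.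
have Dz : is_derive t 1 (cz g) (z' t) by case: Cz => _ _; exact.
rewrite /density /hspeed !derive1E !derive_val Npt_hdistE.
apply: planar_bound => //.
- exact: sqrtB1_gt0 (z1 t ctd).
- by rewrite sqr_sqrtr // subr_ge0 exprn_ege1 // ltW // z1.
- exact: powR_ge0.
- exact: onH2_sqr (Hg t ctd).
- exact: (onH2_tangent Hg tcd).
- by rewrite divr_ge0 ?powR_ge0 // addr_ge0 // ltW.
- rewrite /S -sinh_arcosh; last by rewrite ltW // z1.
  by apply: powR_primitive_le_sinh => //; apply: arcosh_ge0; rewrite ltW // z1.
Qed.

End Calibrations.

(** * Points on the same ray *)

Section Crossings.
Variable R : realType.
Implicit Types (c d t m M : R) (g : R -> R * R * R).
Local Notation mu := (@lebesgue_measure R).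

(** Used to pick the first or the last time at level [m]. *)
Lemma level_compact (r : R -> R) c d m : {within `[c, d], continuous r} ->
  compact (`[c, d] `&` [set t | r t = m]).
Proof.
move=> /continuous_closedP /(_ _ (@closed_eq R m)) /closed_subspaceP[V clV VE].
by rewrite setIC -VE setIC; apply: compact_closedI => //; exact: segment_compact.
Qed.

(** Let [c'] be the last time at level [m] and [d'] a time after it at level [M]. A value below [m]
    after [c'] would force a further passage through [m], because [r d >= m]. *)
Lemma upcrossing (r : R -> R) c d m M : c <= d -> {within `[c, d], continuous r} ->
  r c <= m -> m <= M -> M <= r d ->
  exists c' d', [/\ c <= c', c' <= d', d' <= d, r c' = m /\ r d' = M &
    forall t, c' <= t <= d' -> m <= r t].
Proof.
move=> cd cr rcm mM Mrd.
have [t0] : exists2 t, t \in `[c, d] & r t = m.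
  by apply: IVT => //; rewrite ge_min rcm /= le_max (le_trans mM Mrd) orbT.
rewrite in_itv /= => t0cd rt0.
have cid (A : set R) : {within A, continuous (@idfun R)}.
  by apply: continuous_subspaceT => ?; exact: cvg_id.
have [||//|c' /[!inE] -[/=]] := @compact_EVT_max _ R idfun (`[c, d] `&` [set t | r t = m]).
- by exists t0; split; rewrite //= in_itv.
- exact: level_compact.
rewrite in_itv /= => /andP[cc' c'd] rc' c'max.
have [d'] : exists2 t, t \in `[c', d] & r t = M.
  by apply: IVT => //; [exact: within_itvW cr|rewrite rc' ge_min mM /= le_max Mrd orbT].
rewrite in_itv /= => /andP[c'd' d'd] rd'.
exists c', d'; split => // t /andP[c't td']; rewrite leNgt; apply/negP => rtm.
have td := le_trans td' d'd; have ct := le_trans cc' c't.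
have [s] : exists2 s, s \in `[t, d] & r s = m.
  apply: IVT => //; first exact: within_itvW cr.
  by rewrite ge_min (ltW rtm) /= le_max (le_trans mM Mrd) orbT.
rewrite in_itv /= => /andP[ts sd] rs.
have sc' : s <= c' by apply: c'max; rewrite inE; split; rewrite //= in_itv /= sd (le_trans ct ts).
have E : t = c' by apply/eqP; rewrite eq_le c't (le_trans ts sc').
by move: rtm; rewrite E rc' ltxx.
Qed.

(** The mirror image of [upcrossing]: [d'] is the first time at level [m], and [c'] a time before it
    at level [M]. *)
Lemma downcrossing (r : R -> R) c d m M : c <= d -> {within `[c, d], continuous r} ->
  M <= r c -> m <= M -> r d <= m ->
  exists c' d', [/\ c <= c', c' <= d', d' <= d, r c' = M /\ r d' = m &
    forall t, c' <= t <= d' -> m <= r t].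
Proof.
move=> cd cr Mrc mM rdm.
have [t0] : exists2 t, t \in `[c, d] & r t = m.
  by apply: IVT => //; rewrite ge_min rdm orbT /= le_max (le_trans mM Mrc).
rewrite in_itv /= => t0cd rt0.
have cid (A : set R) : {within A, continuous (@idfun R)}.
  by apply: continuous_subspaceT => ?; exact: cvg_id.
have [||//|d' /[!inE] -[/=]] := @compact_EVT_min _ R idfun (`[c, d] `&` [set t | r t = m]).
- by exists t0; split; rewrite //= in_itv.
- exact: level_compact.
rewrite in_itv /= => /andP[cd' d'd] rd' d'min.
have [c'] : exists2 t, t \in `[c, d'] & r t = M.
  by apply: IVT => //; [exact: within_itvW cr|rewrite rd' ge_min mM orbT /= le_max Mrc].
rewrite in_itv /= => /andP[cc' c'd'] rc'.
exists c', d'; split => // t /andP[c't td']; rewrite leNgt; apply/negP => rtm.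
have td := le_trans td' d'd; have ct := le_trans cc' c't.
have [s] : exists2 s, s \in `[c, t] & r s = m.
  apply: IVT => //; first exact: within_itvW cr.
  by rewrite ge_min (ltW rtm) orbT /= le_max (le_trans mM Mrc).
rewrite in_itv /= => /andP[cs st] rs.
have sd' : d' <= s by apply: d'min; rewrite inE; split; rewrite //= in_itv /= cs (le_trans st td).
have E : t = d' by apply/eqP; rewrite eq_le td' (le_trans sd' st).
by move: rtm; rewrite E rd' ltxx.
Qed.

Lemma hdist_gt0 (p : R * R * R) : onH2 p -> (0 < hdist p (@Npt R)) = (1 < pz p).
Proof.
move=> Hp; rewrite Npt_hdistE; apply/idP/idP; last exact: arcosh_gt0.
move=> a0; rewrite lt_neqAle onH2_ge1 // andbT; apply/eqP => p1.
by move: a0; rewrite -p1 /arcosh expr1n subrr sqrtr0 addr0 ln1 ltxx.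
Qed.

(** A crossing between the levels [m] and [M] stays at distance at least [m > 0] from [N]. There [P]
    calibrates, and the nonnegative density on the rest is dropped. The two alternatives are the two
    directions of travel. *)
Lemma energy_ge_radial alpha (P : R -> R) g a b c d m M : pwC1 g a b ->
  (forall t, a <= t <= b -> onH2 (g t)) ->
  (forall u : R, 0 < u -> is_derive u 1 P (u `^ alpha)) ->
  a <= c -> c <= d -> d <= b -> 0 < m -> m <= M ->
  let r t := hdist (g t) (@Npt R) in
  (r c <= m /\ M <= r d) \/ (M <= r c /\ r d <= m) ->
  ((P M - P m)%:E <= \int[mu]_(t in `[c, d]) (density alpha g t)%:E)%E.
Proof.
move=> gab Hg DP ac cd db m0 mM r rcd.
have Hg' t : c <= t <= d -> onH2 (g t).
  by move=> /andP[ct td]; apply: Hg; rewrite (le_trans ac ct) (le_trans td db).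
have cr : {within `[c, d], continuous r}.
  apply: hdist_continuous; last by move=> t /=; rewrite in_itv; exact: Hg'.
  by case: (pwC1_continuous gab) => _ _; exact: within_itvW.
have md := measurable_density alpha gab Hg.
have main c' d' : c <= c' -> c' <= d' -> d' <= d -> (forall t, c' <= t <= d' -> m <= r t) ->
  (`|P (r d') - P (r c')|%:E <= \int[mu]_(t in `[c, d]) (density alpha g t)%:E)%E.
  move=> cc' c'd' d'd mr.
  apply: (@le_trans _ _ (\int[mu]_(t in `[c', d']) (density alpha g t)%:E)%E); last first.
    by apply: ge0_integral_itvW => //; [exact: measurable_fun_itvW md|exact: density_ge0].
  apply: (@pwC1_increment_le _ `[c', d']%classic g (fun t => P (r t)) _ a b) => //.
  - exact: density_ge0.
  - move=> c1 d1 cd1 sub1 C1g.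
    have tcd t : c1 <= t <= d1 -> c' <= t <= d'.
      by move=> tcd; have := sub1 t; rewrite /= !in_itv; exact.
    have H1 t : c1 <= t <= d1 -> onH2 (g t).
      by move=> /tcd /andP[ct td]; apply: Hg'; rewrite (le_trans cc' ct) (le_trans td d'd).
    apply: radial_C1 => // t t1.
    rewrite -[cz g t]/(pz (g t)) -hdist_gt0; last exact: H1.
    by apply: lt_le_trans m0 _; apply: mr; exact: tcd.
  - exact: le_trans cc'.
  - exact: le_trans db.
case: rcd => -[rc rd].
  have [c' [d' [cc' c'd' d'd [rc' rd'] mr]]] := upcrossing cd cr rc mM rd.
  by apply: le_trans (main c' d' cc' c'd' d'd mr); rewrite rc' rd' lee_fin ler_norm.
have [c' [d' [cc' c'd' d'd [rc' rd'] mr]]] := downcrossing cd cr rc mM rd.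
by apply: le_trans (main c' d' cc' c'd' d'd mr); rewrite rc' rd' lee_fin distrC ler_norm.
Qed.

Lemma is_derive_affine (s1 s2 t : R) :
  is_derive t 1 (fun v : R => s1 + v * (s2 - s1)) (s2 - s1).
Proof.
have D1 := is_deriveM (is_derive_id t (1:R)) (is_derive_cst (s2 - s1 : R) t 1).
have D := is_deriveD (is_derive_cst (s1 : R) t 1) D1.
by apply: is_derive_eq; rewrite /GRing.scale /=; ring.
Qed.

Lemma hspeed_geod_seg (v0 s1 s2 t : R) : hspeed (geod_seg v0 s1 s2) t = `|s2 - s1|.
Proof.
have Ds := is_derive_affine s1 s2 t.
have Dsh := is_derive1_comp (g := fun v : R => s1 + v * (s2 - s1)) (is_derive_sinh _) Ds.
have Dch := is_derive1_comp (g := fun v : R => s1 + v * (s2 - s1)) (is_derive_cosh _) Ds.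
have Dx := is_deriveM Dsh (is_derive_cst (cos v0) t 1).
have Dy := is_deriveM Dsh (is_derive_cst (sin v0) t 1).
rewrite /hspeed !derive1E.
rewrite (@derive_val _ _ _ _ _ _ _ Dx) (@derive_val _ _ _ _ _ _ _ Dy) (@derive_val _ _ _ _ _ _ _ Dch).
rewrite /GRing.scale /= -sqrtr_sqr; congr Num.sqrt.
set C := cosh _; set S := sinh _.
rewrite -[RHS]mul1r -(cosh2_sinh2 (s1 + t * (s2 - s1))) -/C -/S.
rewrite -[X in _ = (X - _) * _]mulr1 -(cos2Dsin2 v0); ring.
Qed.

Lemma hdist_Psi (u v : R) : hdist (Psi u v) (@Npt R) = `|u|.
Proof. by rewrite Npt_hdistE /= arcosh_cosh. Qed.

Lemma energy_geod_seg (alpha v0 s1 s2 : R) :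
  energy alpha (geod_seg v0 s1 s2) 0 1 =
  (\int[mu]_(t in `[0%R, 1%R]) (`|s1 + t * (s2 - s1)| `^ alpha * `|s2 - s1|)%:E)%E.
Proof.
by apply: eq_integral => t _; rewrite hspeed_geod_seg /geod_seg hdist_Psi.
Qed.

(** Monotone convergence along inner intervals that exhaust []0, 1[]. *)
Lemma ge0_integral_inner_le (f : R -> R) (E : \bar R) : measurable_fun setT f ->
  (forall t, 0 <= f t) ->
  (forall eps : R, 0 < eps < 2^-1 -> (\int[mu]_(t in `[eps, (1 - eps)%R]) (f t)%:E <= E)%E) ->
  (\int[mu]_(t in `[0%R, 1%R]) (f t)%:E <= E)%E.
Proof.
move=> mf f0 H.
have mfS (A : set R) : measurable_fun A (EFin \o f).
  by apply/measurable_EFinP; exact: measurable_funTS.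
rewrite (integral_itv_bndoo true false (mfS _)).
(* The shift by [3] keeps the margin strictly below [1 / 2], as the hypothesis on [eps] demands. *)
pose F (n : nat) := `[(n.+3%:R : R)^-1, 1 - n.+3%:R^-1]%classic.
have -> : `]0, 1[%classic = \bigcup_n F n.
  apply/seteqP; split => t /=.
    rewrite in_itv /= => /andP[t0 t1].
    pose q := Num.min t (1 - t).
    have q0 : 0 < q by rewrite lt_min t0 subr_gt0.
    have [n _ nq] := near_infty_natSinv_lt (PosNum q0).
    exists n => //=.
    have : (n.+3%:R : R)^-1 < q.
      have /= := nq n (leqnn n); apply: le_lt_trans.
      by rewrite lef_pV2 ?posrE // ler_nat; exact: leqW (leqnSn _).
    rewrite lt_min => /andP[/ltW n1 /ltW n2].
    by rewrite /F /= in_itv /= n1 /= lerBrDr addrC -lerBrDr.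
  move=> [n _]; rewrite /F /= !in_itv /= => /andP[n1 n2].
  have n0 : 0 < (n.+3%:R : R)^-1 by rewrite invr_gt0.
  by rewrite (lt_le_trans n0 n1) (le_lt_trans n2) // ltrBlDr ltrDl.
have cvgF : (\int[mu]_(t in F n) (f t)%:E)%E @[n --> \oo] --> (\int[mu]_(t in \bigcup_n F n) (f t)%:E)%E.
  apply: (@ge0_nondecreasing_set_cvg_integral _ (measurableTypeR R) R F (fun t => (f t)%:E) mu).
  - move=> n k nk; rewrite subsetEset => t; rewrite /F /= !in_itv /= => /andP[n1 n2].
    have : (k.+3%:R : R)^-1 <= n.+3%:R^-1 by rewrite lef_pV2 ?posrE // ler_nat.
    by move=> kn; rewrite (le_trans kn n1) (le_trans n2) // lerD2l lerN2.
  - by move=> n; exact: measurable_itv.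
  - by move=> n; exact: (mfS (F n)).
  - by move=> n t _; rewrite lee_fin.
apply: cvge_le cvgF; apply: nearW => n; apply: H.
by rewrite invr_gt0 ltr0n /= ltf_pV2 ?posrE // ltr_nat.
Qed.

End Crossings.

(** * Minimality of the segment of a ray *)

Section SameRay.
Variable R : realType.
Implicit Types (c d t m M : R) (g : R -> R * R * R).
Local Notation mu := (@lebesgue_measure R).

Lemma C1_with_affine (s1 s2 c d : R) :
  C1_with (fun t => s1 + t * (s2 - s1)) (fun=> s2 - s1) c d.
Proof.
split.
- apply: continuous_subspaceT => t; apply: cvgD; first exact: cvg_cst.
  by apply: cvgM; [exact: cvg_id|exact: cvg_cst].
- by apply: continuous_subspaceT => t; exact: cvg_cst.
- by move=> t _; exact: is_derive_affine.
Qed.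

Lemma measurable_seg_density (alpha s1 s2 : R) :
  measurable_fun setT (fun t : R => `|s1 + t * (s2 - s1)| `^ alpha * `|s2 - s1|).
Proof.
apply: measurable_funM; last exact: measurable_cst.
apply: (@measurableT_comp _ _ _ _ _ _ (fun v : R => v `^ alpha)); first exact: measurable_powR.
apply: measurableT_comp => //.
by apply: measurable_funD => //; exact: measurable_funM.
Qed.

(** When an end is [N] and [alpha <= -1], the segment has infinite energy. Each inner part has
    finite energy, equal to an increment of [P], and the curve has to cross between the levels of
    its two ends. *)
Lemma energy_same_ray (alpha v0 s1 s2 : R) g a b : 0 <= s1 -> 0 <= s2 ->
  curve_joining g a b (Psi s1 v0) (Psi s2 v0) ->
  (energy alpha (geod_seg v0 s1 s2) 0 1 <= energy alpha g a b)%E.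
Proof.
move=> s10 s20 [ab [Hg [ga [gb gC1]]]]; rewrite energy_geod_seg.
have E0 : (0 <= energy alpha g a b)%E.
  by apply: integral_ge0 => t _; rewrite lee_fin; exact: density_ge0.
have [<-|s12] := eqVneq s1 s2.
  rewrite (_ : (fun t => _) = cst 0%E) ?integral0 //.
  by apply/funext => t; rewrite subrr normr0 mulr0.
have [P DP] := powR_primitive alpha.
apply: ge0_integral_inner_le.
- exact: measurable_seg_density.
- by move=> t; rewrite mulr_ge0 ?powR_ge0.
move=> eps /andP[e0 e1].
have e12 : eps < 1 - eps by lra.
pose sigma (t : R) := s1 + t * (s2 - s1).
(* [sigma t] is a convex combination with positive weights of two nonnegative numbers that are not
   both zero. *)
have sp t : eps <= t <= 1 - eps -> 0 < sigma t.
  move=> /andP[t1 t2]; rewrite /sigma (_ : s1 + _ = (1 - t) * s1 + t * s2); last ring.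
  have t0 : 0 < t by lra.
  have t10 : 0 < 1 - t by lra.
  move: s10; rewrite le_eqVlt => /predU1P[s0|s0].
    rewrite -s0 mulr0 add0r mulr_gt0 // lt_neqAle s20 andbT.
    by rewrite {1}s0.
  by rewrite ltr_wpDr ?mulr_gt0 // mulr_ge0 // ltW.
(* The sign turns the factor [s2 - s1] of the chain rule into [|s2 - s1|], so that one computation
   serves both orders of [s1] and [s2]. *)
have CP : C1_with (fun t => Num.sg (s2 - s1) * P (sigma t))
    (fun t => Num.sg (s2 - s1) * (sigma t `^ alpha * (s2 - s1))) eps (1 - eps).
  apply: C1_withZ; apply: (@C1_with_comp _ P (fun v => v `^ alpha)) => //.
  - exact: C1_with_affine.
  - by move=> t /sp; exact: DP.
  - by move=> t /sp; exact: continuous_powRl.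
have -> : (\int[mu]_(t in `[eps, (1 - eps)%R]) (`|s1 + t * (s2 - s1)| `^ alpha * `|s2 - s1|)%:E =
    (Num.sg (s2 - s1) * P (sigma (1 - eps)) - Num.sg (s2 - s1) * P (sigma eps))%:E)%E.
  rewrite -(C1_integral e12 CP); apply: eq_integral => t.
  rewrite inE /= in_itv /= => /sp st.
  by rewrite -/(sigma t) (gtr0_norm st) mulrCA -normrEsg.
have se : eps <= eps <= 1 - eps by rewrite lexx ltW.
have s1e : eps <= 1 - eps <= 1 - eps by rewrite lexx ltW.
have ra : hdist (g a) (@Npt R) = s1 by rewrite ga hdist_Psi ger0_norm.
have rb : hdist (g b) (@Npt R) = s2 by rewrite gb hdist_Psi ger0_norm.
have [lt12|lt21|//] := ltgtP s1 s2; last by move=> E; rewrite E eqxx in s12.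
  rewrite gtr0_sg ?subr_gt0 // !mul1r.
  apply: (@energy_ge_radial _ alpha P g a b a b) => //; [exact: ltW|exact: sp| |].
    by rewrite /sigma; nra.
  by left; rewrite ra rb /sigma; split; nra.
rewrite ltr0_sg ?subr_lt0 // !mulN1r opprK addrC.
apply: (@energy_ge_radial _ alpha P g a b a b) => //; [exact: ltW|exact: sp| |].
  by rewrite /sigma; nra.
by right; rewrite ra rb /sigma; split; nra.
Qed.

End SameRay.

(** * Points on opposite rays *)

Section OppositeRays.
Variable R : realType.
Implicit Types (c d t m M : R) (g : R -> R * R * R).
Local Notation mu := (@lebesgue_measure R).

Lemma continuous_norm_powR (alpha : R) : 0 < alpha ->
  continuous (fun v : R => `|v| `^ alpha).
Proof.
move=> a0 u; have [->|u0] := eqVneq u 0; last first.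
  apply: (@continuous_comp _ _ _ (fun v : R => `|v|) (fun v : R => v `^ alpha)).
    exact: norm_continuous.
  by apply: continuous_powRl; rewrite normr_gt0.
suff : `|v| `^ alpha @[v --> (0 : R)] --> (0 : R).
  by rewrite /continuous_at normr0 powR0 ?gt_eqF.
apply/cvgr0Pnorm_lt => eps e0.
have d0 : 0 < eps `^ alpha^-1 by exact: powR_gt0.
(* The radius solves [delta ^ alpha = eps]. *)
exists (eps `^ alpha^-1) => //= v; rewrite /ball_ /= sub0r normrN => vd.
rewrite ger0_norm ?powR_ge0 //.
have -> : eps = (eps `^ alpha^-1) `^ alpha.
  by rewrite -powRrM mulVf ?gt_eqF // powRr1 // ltW.
by apply: gt0_ltr_powR => //; rewrite nnegrE // ltW.
Qed.

Lemma powR_mul_id (alpha u : R) : 0 < alpha -> 0 <= u -> u * u `^ alpha = u `^ (alpha + 1).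
Proof.
move=> a0 u0; rewrite powRD ?powRr1 //; last by rewrite gt_eqF // addr_gt0.
by rewrite mulrC.
Qed.

(** The odd extension of [P(u) = u ^ (alpha + 1) / (alpha + 1)]: a single primitive of the density
    along the whole geodesic, across [N]. *)
Lemma is_derive_signed_powR (alpha u : R) : 0 < alpha ->
  is_derive u 1 (fun v : R => v * `|v| `^ alpha / (alpha + 1)) (`|u| `^ alpha).
Proof.
move=> a0; have a10 : alpha + 1 != 0 by rewrite gt_eqF // addr_gt0.
have [u0|u0|->] := ltgtP u 0.
- have D := is_derive1_comp (is_derive_powR_primitive a10 (_ : 0 < - u)) (is_deriveNid u 1).
  rewrite oppr_gt0 in D; have {}D := is_deriveN (D u0).
  rewrite ltr0_norm //.
  apply: (@near_eq_is_derive _ _ _ (fun v : R => - ((- v) `^ (alpha + 1) / (alpha + 1)))); last first.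
    by apply: is_derive_eq; rewrite mulrN1 opprK.
  have : u \in `]-oo, 0[ by rewrite in_itv.
  move=> /near_in_itvNyo; apply: filterS => v; rewrite in_itv /= => v0.
  by rewrite ltr0_norm // -powR_mul_id ?oppr_ge0 ?(ltW v0) // !mulNr opprK.
- rewrite gtr0_norm //; apply: near_eq_is_derive (is_derive_powR_primitive a10 u0).
  have : u \in `]0, +oo[ by rewrite in_itv /= u0.
  move=> /near_in_itvoy; apply: filterS => v; rewrite in_itv /= andbT => v0.
  by rewrite gtr0_norm // -powR_mul_id // ltW.
(* At [0] the difference quotient is [|h| ^ alpha / (alpha + 1)], which tends to [0]. *)
- have cv : h^-1 *: (((fun v : R => v * `|v| `^ alpha / (alpha + 1)) \o shift 0) (h *: 1) -
      0 * `|0 : R| `^ alpha / (alpha + 1)) @[h --> (0:R)^'] --> `|0 : R| `^ alpha.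
    have c0 : (fun h : R => `|h| `^ alpha / (alpha + 1)) h @[h --> (0 : R)^'] --> `|0 : R| `^ alpha.
      rewrite normr0 powR0 ?gt_eqF //.
      rewrite -[X in _ --> X](mul0r (alpha + 1)^-1).
      apply: cvgM; last exact: cvg_cst.
      have := @continuous_norm_powR alpha a0 0; rewrite /continuous_at normr0 powR0 ?gt_eqF //.
      by move=> h; apply: cvg_within_filter.
    apply: cvg_trans c0; apply: near_eq_cvg.
    near=> h.
    have h0 : h != 0 by near: h; exact: nbhs_dnbhs_neq.
    by rewrite /= /GRing.scale /= !mul0r subr0 addr0 mulr1 -mulrA mulKf.
  apply: DeriveDef; first by apply/cvg_ex; eexists; exact: cv.
  by apply/cvg_lim.
Unshelve. all: by end_near.
Qed.

(** [energy_ge_radial] needs a positive lower level [m]; letting [m] tend to [0] loses nothing,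
    since [P m] tends to [0]. *)
Lemma energy_ge_from_N alpha g a b c d M : 0 < alpha -> pwC1 g a b ->
  (forall t, a <= t <= b -> onH2 (g t)) -> a <= c -> c <= d -> d <= b -> 0 <= M ->
  let r t := hdist (g t) (@Npt R) in
  (r c = 0 /\ r d = M) \/ (r c = M /\ r d = 0) ->
  ((M `^ (alpha + 1) / (alpha + 1))%:E <= \int[mu]_(t in `[c, d]) (density alpha g t)%:E)%E.
Proof.
move=> a0 gab Hg ac cd db M0 r rcd.
have a1 : 0 < alpha + 1 by rewrite addr_gt0.
have I0 : (0 <= \int[mu]_(t in `[c, d]) (density alpha g t)%:E)%E.
  by apply: integral_ge0 => t _; rewrite lee_fin density_ge0.
move: M0; rewrite le_eqVlt => /predU1P[<-|M0].
  by rewrite powR0 ?gt_eqF // mul0r.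
apply/lee_addgt0Pr => e e0.
(* The second argument solves [P m = e]; the minimum with [M] ensures [m <= M]. *)
pose m := Num.min M ((e * (alpha + 1)) `^ (alpha + 1)^-1).
have m0 : 0 < m by rewrite lt_min M0 powR_gt0 // mulr_gt0.
have mM : m <= M by rewrite ge_min lexx.
have Pm : m `^ (alpha + 1) / (alpha + 1) <= e.
  rewrite ler_pdivrMr //.
  have -> : e * (alpha + 1) = ((e * (alpha + 1)) `^ (alpha + 1)^-1) `^ (alpha + 1).
    by rewrite -powRrM mulVf ?gt_eqF // powRr1 // mulr_ge0 // ltW.
  apply: ge0_ler_powR; rewrite ?nnegrE ?powR_ge0 // ?(ltW a1) ?(ltW m0) //.
  by rewrite ge_min lexx orbT.
have := @energy_ge_radial _ alpha (fun v => v `^ (alpha + 1) / (alpha + 1)) g a b c d m M gab Hg.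
move=> /(_ _ ac cd db m0 mM) H.
have {}H : ((M `^ (alpha + 1) / (alpha + 1) - m `^ (alpha + 1) / (alpha + 1))%:E <=
    \int[mu]_(t in `[c, d]) (density alpha g t)%:E)%E.
  apply: H; first by move=> u u0; apply: is_derive_powR_primitive; rewrite ?gt_eqF.
  by rewrite -/(r c) -/(r d); case: rcd => -[-> ->]; [left|right]; split => //; exact: ltW.
have := leeD H (_ : ((m `^ (alpha + 1) / (alpha + 1))%:E <= e%:E)%E).
by rewrite lee_fin -EFinD subrK; apply.
Qed.

Lemma energy_geod_seg_through_N (alpha v0 s1 s2 : R) : 0 < alpha ->
  s1 <= 0 -> 0 <= s2 -> s1 < s2 ->
  energy alpha (geod_seg v0 s1 s2) 0 1 =
  ((- s1) `^ (alpha + 1) / (alpha + 1) + s2 `^ (alpha + 1) / (alpha + 1))%:E.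
Proof.
move=> a0 s10 s20 s12; rewrite energy_geod_seg.
have CQ : C1_with (fun t => (fun v : R => v * `|v| `^ alpha / (alpha + 1)) (s1 + t * (s2 - s1)))
    (fun t => `|s1 + t * (s2 - s1)| `^ alpha * (s2 - s1)) 0 1.
  apply: (@C1_with_comp _ (fun v : R => v * `|v| `^ alpha / (alpha + 1)) (fun v : R => `|v| `^ alpha)) => //.
  - exact: C1_with_affine.
  - by move=> t _; exact: is_derive_signed_powR.
  - by move=> t _; exact: continuous_norm_powR.
rewrite gtr0_norm ?subr_gt0 // (C1_integral ltr01 CQ) mul1r mul0r addr0 subrKC.
rewrite (ger0_norm s20) (ler0_norm s10) -!powR_mul_id ?oppr_ge0 //.
by congr EFin; ring.
Qed.

(** On the geodesic of direction [v0], [planar] is the signed coordinate of the planar image: [P(u)]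
    on this ray and [- P(-u)] on the opposite one. *)
Lemma planar_Psi_pos (alpha v0 u : R) : 0 < u ->
  planar alpha (cos v0) (sin v0) (Psi u v0) = u `^ (alpha + 1) / (alpha + 1).
Proof.
move=> u0; have S0 : 0 < sinh u := lt_le_trans u0 (sinh_ge_id (ltW u0)).
rewrite /planar /px /py /pz /= arcosh_cosh gtr0_norm //.
rewrite (_ : cosh u ^+ 2 - 1 = sinh u ^+ 2); last by rewrite -(cosh2_sinh2 u); ring.
rewrite sqrtr_sqr gtr0_norm //.
rewrite (_ : cos v0 * _ + _ = sinh u); last first.
  by rewrite -[RHS]mulr1 -(cos2Dsin2 v0); ring.
by rewrite mulrC divfK // gt_eqF.
Qed.

Lemma Psi_opp (u v : R) : Psi (- u) v = (- px (Psi u v), - py (Psi u v), pz (Psi u v)).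
Proof. by rewrite /Psi /px /py /pz /= sinhN coshN !mulNr. Qed.

Lemma planar_Psi_neg (alpha v0 u : R) : u < 0 ->
  planar alpha (cos v0) (sin v0) (Psi u v0) = - ((- u) `^ (alpha + 1) / (alpha + 1)).
Proof.
move=> u0; rewrite -[in LHS](opprK u) Psi_opp -(planar_Psi_pos _ v0) ?oppr_gt0 //.
by rewrite /planar /px /py /pz /= !mulrN -opprD mulNr.
Qed.

Lemma energy_through_N (alpha v0 s1 s2 : R) g a b : 0 < alpha -> s1 <= 0 -> 0 <= s2 ->
  curve_joining g a b (Psi s1 v0) (Psi s2 v0) ->
  (energy alpha (geod_seg v0 s1 s2) 0 1 <= energy alpha g a b)%E.
Proof.
move=> a0 s10 s20 [ab [Hg [ga [gb gC1]]]].
(* Without [s1 < s2] both parameters are [0], and the segment is the point [N], with zero energy. *)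
have [s12|s21] := ltP s1 s2; last first.
  rewrite energy_geod_seg (_ : (fun t => _) = cst 0%E); last first.
    have -> : s1 = s2 by apply/eqP; rewrite eq_le s21 (le_trans s10 s20).
    by apply/funext => t; rewrite subrr normr0 mulr0.
  by rewrite integral0; apply: integral_ge0 => t _; rewrite lee_fin; exact: density_ge0.
rewrite energy_geod_seg_through_N //.
have md := measurable_density alpha gC1 Hg.
have ra : hdist (g a) (@Npt R) = - s1 by rewrite ga hdist_Psi ler0_norm.
have rb : hdist (g b) (@Npt R) = s2 by rewrite gb hdist_Psi ger0_norm.
have [[tau /andP[atau taub] rtau]|noN] :=
  pselect (exists2 t, a <= t <= b & hdist (g t) (@Npt R) = 0).
  rewrite /energy (@ge0_integral_itv_cat _ a tau b (density alpha g)) //; last exact: density_ge0.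
  rewrite EFinD; apply: leeD.
    by apply: (@energy_ge_from_N _ g a b) => //; [rewrite oppr_ge0|right].
  by apply: (@energy_ge_from_N _ g a b) => //; left.
have z1 t : a <= t <= b -> 1 < cz g t.
  move=> tab; rewrite -[cz g t]/(pz (g t)) -hdist_gt0; last exact: Hg.
  rewrite lt_neqAle; apply/andP; split.
    by apply/eqP => r0; apply: noN; exists t.
  by rewrite Npt_hdistE arcosh_ge0 // onH2_ge1 //; exact: Hg.
(* An end at [N] would be a passage through [N]; the strict signs then give the values of [planar]
   at both ends. *)
have s1lt : s1 < 0.
  rewrite lt_neqAle s10 andbT; apply/eqP => s0.
  by apply: noN; exists a; rewrite ?ra ?s0 ?oppr0 // lexx ltW.
have s2gt : 0 < s2.
  rewrite lt_neqAle s20 andbT; apply/eqP => s0.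
  by apply: noN; exists b; rewrite ?rb -?s0 // lexx ltW.
apply: (@le_trans _ _ (`|planar alpha (cos v0) (sin v0) (g b) - planar alpha (cos v0) (sin v0) (g a)|%:E)).
  rewrite ga gb planar_Psi_pos // planar_Psi_neg // opprK addrC lee_fin.
  exact: ler_norm.
(* The curve avoids [N], so the calibration holds on all of [[a, b]]. *)
apply: (@pwC1_increment_le _ `[a, b]%classic g (fun t => planar alpha (cos v0) (sin v0) (g t))
  (density alpha g) a b) => //; [exact: density_ge0| |exact: ltW].
move=> c d cd sub C1g.
have tcd t : c <= t <= d -> a <= t <= b.
  by move=> tcd; have := sub t; rewrite /= !in_itv; exact.
apply: planar_C1 => //; first exact: cos2Dsin2.
- by move=> t /tcd; exact: Hg.
- by move=> t /tcd; exact: z1.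
Qed.

End OppositeRays.

Theorem theorem2p11 (R : realType) (alpha : R) (v0 s1 s2 : R)
    (p1 p2 : R * R * R) :
  alpha != 0 ->
  p1 = Psi s1 v0 -> p2 = Psi s2 v0 ->
  ((0 <= s1 -> 0 <= s2 ->
     forall (g : R -> R * R * R) (a b : R), curve_joining g a b p1 p2 ->
       (energy alpha (geod_seg v0 s1 s2) 0 1 <= energy alpha g a b)%E)
  /\
  (0 < alpha -> s1 <= 0 -> 0 <= s2 ->
     forall (g : R -> R * R * R) (a b : R), curve_joining g a b p1 p2 ->
       (energy alpha (geod_seg v0 s1 s2) 0 1 <= energy alpha g a b)%E)).
Proof.
move=> _ -> ->; split => [s10 s20 g a b|a0 s10 s20 g a b].
  exact: energy_same_ray.
exact: energy_through_N.
Qed.
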